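(* Let $\mathcal{K}\hookrightarrow\mathcal{L}$ be an inclusion of finite simplicial complexes and let $q\ge 0$ be such that the persistent up Laplacian $\Delta_{q,\mathrm{up}}^{\mathcal{K},\mathcal{L}}$ is nonzero. Let $\lambda_{\min}^+$ denote the smallest nonzero eigenvalue of $\Delta_{q,\mathrm{up}}^{\mathcal{K},\mathcal{L}}$, and let $\varphi_q^{\mathcal{K},\mathcal{L}}$ be the persistent Cheeger constant. Then $$\frac{\bigl(\varphi_q^{\mathcal{K},\mathcal{L}}\bigr)^2}{|S_{q+1}^{\mathcal{L}}|}\;\le\;\lambda_{\min}^+\;\le\;|S_q^{\mathcal{K}}|\,\bigl(\varphi_q^{\mathcal{K},\mathcal{L}}\bigr)^2 .$$ In particular, when $\mathcal{K}=\mathcal{L}$, the smallest nonzero eigenvalue $\lambda_{\min}^+$ of the ordinary up Laplacian $\Delta_{q,\mathrm{up}}^{\mathcal{L}}=\partial_{q+1}^{\mathcal{L}}(\partial_{q+1}^{\mathcal{L}})^*$ satisfies $$\frac{(\varphi_q^{\mathcal{L}})^2}{|S_{q+1}^{\mathcal{L}}|}\le\lambda_{\min}^+\le|S_q^{\mathcal{L}}|(\varphi_q^{\mathcal{L}})^2,\qquad \varphi_q^{\mathcal{L}}:=\varphi_q^{\mathcal{L},\mathcal{L}}.$$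
   Context: For a finite simplicial complex $\mathcal{X}$ with chosen orientations, $S_q^{\mathcal{X}}$ is the set of $q$-simplices, $C_q^{\mathcal{X}}$ is the space of real $q$-chains with the inner product for which $S_q^{\mathcal{X}}$ is orthonormal, $\partial_q^{\mathcal{X}}:C_q^{\mathcal{X}}\to C_{q-1}^{\mathcal{X}}$ is the boundary operator, and $B_q^{\mathcal{X}}$ is its matrix in the simplex bases. Norms $\|\cdot\|_1$ are $\ell^1$-norms with respect to the simplex bases. For $\mathcal{K}\subseteq\mathcal{L}$ put $C_{q+1}^{\mathcal{L},\mathcal{K}}=\{c\in C_{q+1}^{\mathcal{L}}:\partial_{q+1}^{\mathcal{L}}c\in C_q^{\mathcal{K}}\}$ with the restricted inner product, and let $\partial_{q+1}^{\mathcal{L},\mathcal{K}}:C_{q+1}^{\mathcal{L},\mathcal{K}}\to C_q^{\mathcal{K}}$ be the restriction of $\partial_{q+1}^{\mathcal{L}}$. The persistent up Laplacian is $\Delta_{q,\mathrm{up}}^{\mathcal{K},\mathcal{L}}=\partial_{q+1}^{\mathcal{L},\mathcal{K}}\circ(\partial_{q+1}^{\mathcal{L},\mathcal{K}})^*:C_q^{\mathcal{K}}\to C_q^{\mathcal{K}}$. Let $B$ be the submatrix of $B_{q+1}^{\mathcal{L}}$ consisting of the rows indexed by $S_q^{\mathcal{K}}$, and let $P:C_{q+1}^{\mathcal{L}}\to C_{q+1}^{\mathcal{L}}$ be the orthogonal projection onto $C_{q+1}^{\mathcal{L},\mathcal{K}}$. For a vector $x$ and a linear subspace $Y$, write $x\perp^1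 Y$ if $\|x+y\|_1\ge\|x\|_1$ for every $y\in Y$. The persistent Cheeger constant is $$\varphi_q^{\mathcal{K},\mathcal{L}}=\min_{\substack{0\ne x\in C_q^{\mathcal{K}}\\ x\perp^1\ker(PB^T)}}\frac{\|PB^Tx\|_1}{\|x\|_1}.$$ *)

(* Defs.v *)
From HB Require Import structures.
From mathcomp Require Import all_boot all_order all_algebra all_fingroup.
From mathcomp Require Import boolp classical_sets reals.
(* Imported last so that set0 and the other set names denote finite sets. *)
From mathcomp Require Import finset.

Set Implicit Arguments.
Unset Strict Implicit.
Unset Printing Implicit Defensive.

Import Order.TTheory GRing.Theory Num.Theory.
Local Open Scope ring_scope.

(* A finite simplicial complex whose vertices lie in the finite set V (not every
   element of V has to be a vertex). *)
Record simplicial_complex (V : finType) := SimplicialComplex {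
  faces : {set {set V}};
  faces_nonempty : set0 \notin faces;
  faces_closed : forall s t : {set V},
    s \in faces -> t \subset s -> t != set0 -> t \in faces }.

Definition simplices (V : finType) (K : simplicial_complex V) (q : nat) :
  {set {set V}} := [set s in faces K | #|s| == q.+1].

(* An orientation of s is represented by an ordering of its vertices, two
   orderings being equivalent when they differ by an even permutation.  Choosing
   the orderings for all subsets of V at once makes the orientations of a
   complex and of its subcomplexes agree. *)
Record orientation (V : finType) := Orientation {
  ordering :> {set V} -> seq V;
  orderingP : forall s : {set V}, perm_eq (ordering s) (enum s) }.

Section Chains.
Variable R : realType.

(* The sign of the permutation turning s into t; for s without repetition at
   most one permutation p contributes, and none does unless t rearranges s. *)
Definition rearrangement_sign (T : eqType) (s t : seq T) : R :=
  \sum_(p : 'S_(size s) | [seq tnth (in_tuple s) (p i) | i : 'I_(size s)] == t)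
    (-1) ^+ p.

(* The coefficient of t in the boundary of s = [v_0, ..., v_n], which is
   \sum_i (-1)^i [v_0, ..., v_(i-1), v_(i+1), ..., v_n]. *)
Definition incidence (V : finType) (o : orientation V) (t s : {set V}) : R :=
  \sum_(i < size (o s))
    (-1) ^+ i * rearrangement_sign (take i (o s) ++ drop i.+1 (o s)) (o t).

(* Chains are identified with their coordinate vectors in the simplex basis. *)
Definition chains (V : finType) (K : simplicial_complex V) (q : nat) :=
  'cV[R]_#|simplices K q|.

(* The block of the (q+1)-st boundary matrix of L whose rows are indexed by the
   q-simplices of K; for K = L this is the whole boundary matrix. *)
Definition boundary_mx (V : finType) (o : orientation V)
    (K L : simplicial_complex V) (q : nat) :
    'M[R]_(#|simplices K q|, #|simplices L q.+1|) :=
  \matrix_(i, j) incidence o (enum_val i) (enum_val j).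

(* The boundary operator from (q+1)-chains to q-chains. *)
Definition boundary (V : finType) (o : orientation V)
    (L : simplicial_complex V) (q : nat) : 'Hom(chains L q.+1, chains L q) :=
  linfun (mulmx (boundary_mx o L L q)).

Definition dot (n : nat) (u v : 'cV[R]_n) : R := \sum_i u i 0 * v i 0.

Definition l1norm (n : nat) (u : 'cV[R]_n) : R := \sum_i `|u i 0|.

(* The adjoint of f for the inner products ipU and ipW. *)
Definition adjoint (U W : vectType R) (ipU : U -> U -> R) (ipW : W -> W -> R)
    (f : 'Hom(U, W)) : 'Hom(W, U) :=
  xget 0 [set g : 'Hom(W, U) | forall u w, ipW (f u) w = ipU u (g w)]%classic.

Definition orthogonal_projection (n : nat) (Y : {vspace 'cV[R]_n}) :
    'End('cV[R]_n) :=
  xget 0 [set P : 'End('cV[R]_n) | forall c,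
    P c \in Y /\ forall y, y \in Y -> dot (c - P c) y = 0]%classic.

(* The least element of A; 0 when A has none. *)
Definition minimum (A : set R) : R := xget 0 (A `&` lbound A)%classic.

Definition smallest_nonzero_eigenvalue (U : vectType R) (f : 'End(U)) : R :=
  minimum [set a | passmx.leigenvalue f a /\ a != 0]%classic.

Definition up_laplacian (V : finType) (o : orientation V)
    (L : simplicial_complex V) (q : nat) : 'End(chains L q) :=
  (boundary o L q \o adjoint (@dot _) (@dot _) (boundary o L q))%VF.

Section Persistent.
Variables (V : finType) (o : orientation V) (K L : simplicial_complex V).
Variable q : nat.

(* For K a subcomplex of L, the inclusion of the q-chains of K in those of L. *)
Definition chain_inclusion : 'Hom(chains K q, chains L q) :=
  linfun (mulmx (\matrix_(i, j) (enum_val i == enum_val j)%:R)).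

(* The (q+1)-chains of L whose boundary is a chain of K. *)
Definition relative_chains : {vspace chains L q.+1} :=
  (boundary o L q @^-1: limg chain_inclusion)%VS.

Definition persistent_boundary : 'Hom(subvs_of relative_chains, chains K q) :=
  (chain_inclusion^-1 \o boundary o L q \o linfun vsval)%VF.

Definition persistent_up_laplacian : 'End(chains K q) :=
  (persistent_boundary \o
   adjoint (fun u v => dot (vsval u) (vsval v)) (@dot _) persistent_boundary)%VF.

Definition projected_coboundary : 'Hom(chains K q, chains L q.+1) :=
  (orthogonal_projection relative_chains \o
   linfun (mulmx (boundary_mx o K L q)^T))%VF.

End Persistent.

Definition l1_perp (n : nat) (x : 'cV[R]_n) (Y : {vspace 'cV[R]_n}) : Prop :=
  forall y, y \in Y -> l1norm x <= l1norm (x + y).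

Definition persistent_cheeger (V : finType) (o : orientation V)
    (K L : simplicial_complex V) (q : nat) : R :=
  let PBt := projected_coboundary o K L q in
  minimum [set l1norm (PBt x) / l1norm x
          | x in [set x | x != 0 /\ l1_perp x (lker PBt)]]%classic.

End Chains.

(* Main.v *)
(* Write A = P B^T.  The persistent boundary D acts on the relative chains as B,
   so D^* = A and the persistent up Laplacian is D D^* = A^T A; its smallest nonzero eigenvalue
   lambda is the minimum of |A x|_2^2 / |x|_2^2 over x orthogonal to ker A.
   - Upper bound: let x attain phi and let k be its orthogonal projection to
     ker A.  As x is l1-perpendicular to ker A,
     |x|_1 <= |x - k|_1 <= sqrt n |x - k|_2 <= sqrt (n / lambda) |A x|_2, and
     |A x|_2 <= |A x|_1.
   - Lower bound: let x be an eigenvector for lambda and let z minimize the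
     l1-norm on x + ker A.  Then z is admissible for phi, A z = A x and
     |z|_1 >= |z|_2 >= |x|_2, while |A x|_1 <= sqrt m |A x|_2. *)

Require Import Defs.
From HB Require Import structures.
From mathcomp Require Import all_boot all_order all_algebra all_fingroup.
From mathcomp Require Import reals.
From mathcomp Require Import ring lra.
From mathcomp Require Import boolp classical_sets topology normedtype derive.
From mathcomp Require Import finset.

Set Implicit Arguments.
Unset Strict Implicit.
Unset Printing Implicit Defensive.

Import Order.TTheory GRing.Theory Num.Theory.
Import numFieldNormedType.Exports.
Local Open Scope ring_scope.

(** * Inner product and l1-norm of column vectors *)

Lemma dotC (R : realType) n (u v : 'cV[R]_n) : dot u v = dot v u.
Proof. by apply: eq_bigr => i _; rewrite mulrC. Qed.

Lemma dotPl (R : realType) n (a : R) (u v w : 'cV[R]_n) :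
  dot (a *: u + v) w = a * dot u w + dot v w.
Proof.
rewrite /dot mulr_sumr -big_split; apply: eq_bigr => i _ /=.
by rewrite !mxE mulrDl mulrA.
Qed.

Lemma dotDl (R : realType) n (u v w : 'cV[R]_n) :
  dot (u + v) w = dot u w + dot v w.
Proof. by rewrite -{1}[u]scale1r dotPl mul1r. Qed.

Lemma dotZl (R : realType) n (a : R) (u v : 'cV[R]_n) :
  dot (a *: u) v = a * dot u v.
Proof. by rewrite /dot mulr_sumr; apply: eq_bigr => i _; rewrite mxE mulrA. Qed.

Lemma dotBl (R : realType) n (u v w : 'cV[R]_n) :
  dot (u - v) w = dot u w - dot v w.
Proof. by rewrite dotDl -scaleN1r dotZl mulN1r. Qed.

Lemma dotDr (R : realType) n (u v w : 'cV[R]_n) :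
  dot w (u + v) = dot w u + dot w v.
Proof. by rewrite !(dotC w) dotDl. Qed.

Lemma dotZr (R : realType) n (a : R) (u v : 'cV[R]_n) :
  dot u (a *: v) = a * dot u v.
Proof. by rewrite !(dotC u) dotZl. Qed.

Lemma dot0r (R : realType) n (u : 'cV[R]_n) : dot u 0 = 0.
Proof. by rewrite -(scale0r 0) dotZr mul0r. Qed.

Lemma dot_ge0 (R : realType) n (u : 'cV[R]_n) : 0 <= dot u u.
Proof. by apply: sumr_ge0 => i _; rewrite -expr2 sqr_ge0. Qed.

Lemma dot_eq0 (R : realType) n (u : 'cV[R]_n) : (dot u u == 0) = (u == 0).
Proof.
apply/eqP/eqP => [|->]; last by rewrite dot0r.
move=> /psumr_eq0P u0; apply/colP => i; rewrite mxE; apply/eqP.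
by rewrite -[_ == 0]orbb -mulf_eq0 u0 // => j _; rewrite -expr2 sqr_ge0.
Qed.

Lemma dot_gt0 (R : realType) n (u : 'cV[R]_n) : (0 < dot u u) = (u != 0).
Proof. by rewrite lt_def dot_ge0 andbT dot_eq0. Qed.

Lemma dot_ext (R : realType) n (u v : 'cV[R]_n) :
  (forall w, dot u w = dot v w) -> u = v.
Proof.
by move=> uv; apply/eqP; rewrite -subr_eq0 -dot_eq0 dotBl uv subrr.
Qed.

Lemma dot_mulmx (R : realType) m n (M : 'M[R]_(m, n)) u v :
  dot (M *m u) v = dot u (M^T *m v).
Proof.
have dotE k (x y : 'cV[R]_k) : dot x y = (x^T *m y) 0 0.
  by rewrite mxE; apply: eq_bigr => i _; rewrite mxE.
by rewrite !dotE trmx_mul mulmxA.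
Qed.

Lemma l1norm_ge0 (R : realType) n (u : 'cV[R]_n) : 0 <= l1norm u.
Proof. exact: sumr_ge0. Qed.

Lemma l1norm_eq0 (R : realType) n (u : 'cV[R]_n) : (l1norm u == 0) = (u == 0).
Proof.
apply/eqP/eqP => [|->]; last by rewrite /l1norm big1 // => i _; rewrite mxE normr0.
move=> /psumr_eq0P u0; apply/colP => i; rewrite mxE; apply/eqP.
by rewrite -normr_eq0 u0.
Qed.

Lemma l1normZ (R : realType) n (a : R) (u : 'cV[R]_n) :
  l1norm (a *: u) = `|a| * l1norm u.
Proof. by rewrite /l1norm mulr_sumr; apply: eq_bigr => i _; rewrite mxE normrM. Qed.

Lemma le_coord_l1norm (R : realType) n (u : 'cV[R]_n) i : `|u i 0| <= l1norm u.
Proof. by rewrite /l1norm (bigD1 i) //= lerDl sumr_ge0. Qed.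

Lemma dot_le_l1norm (R : realType) n (u : 'cV[R]_n) : dot u u <= l1norm u ^+ 2.
Proof.
rewrite expr2 {2}/l1norm mulr_sumr; apply: ler_sum => i _.
by rewrite -expr2 -real_normK ?num_real // expr2 ler_wpM2r ?le_coord_l1norm.
Qed.

(** Cauchy-Schwarz against the all-ones vector, obtained from Lagrange's identity: the sum of all
    [(a i - a j) ^+ 2] is twice the difference of the two sides. *)
Lemma l1norm_le_dot (R : realType) n (u : 'cV[R]_n) :
  l1norm u ^+ 2 <= n%:R * dot u u.
Proof.
pose a i := `|u i 0|.
have -> : dot u u = \sum_i a i ^+ 2.
  by apply: eq_bigr => i _; rewrite real_normK ?num_real.
have : 0 <= \sum_i \sum_j (a i - a j) ^+ 2.
  by apply: sumr_ge0 => i _; apply: sumr_ge0 => j _; exact: sqr_ge0.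
have -> : \sum_i \sum_j (a i - a j) ^+ 2 =
    2 * (n%:R * (\sum_i a i ^+ 2) - l1norm u ^+ 2).
  transitivity (\sum_i (n%:R * a i ^+ 2 - 2 * (a i * l1norm u) +
                        \sum_j a j ^+ 2)).
    apply: eq_bigr => i _.
    rewrite (eq_bigr (fun j => (a i ^+ 2 - 2 * (a i * a j)) + a j ^+ 2)).
      rewrite big_split big_split /= sumr_const card_ord mulr_natl sumrN.
      by rewrite -!mulr_sumr.
    by move=> j _; ring.
  rewrite big_split big_split /= sumrN -!mulr_sumr -mulr_suml.
  by rewrite sumr_const card_ord -/(l1norm u) mulr_natl; ring.
by rewrite pmulr_rge0 // subr_ge0.
Qed.

(** * Least elements and orthogonal projections *)

Lemma minimumE (R : realType) (A : set R) a :
  A a -> lbound A a -> minimum A = a.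
Proof.
move=> Aa lba; apply: xget_unique => // b [Ab lbb].
by apply/eqP; rewrite eq_le lba // lbb.
Qed.

(** [xget] would return 0 if no projection existed; one is exhibited by splitting the space as [Y]
    plus its orthogonal complement. *)
Lemma orthogonal_projectionP (R : realType) n (Y : {vspace 'cV[R]_n}) c :
  orthogonal_projection Y c \in Y /\
  forall y, y \in Y -> dot (c - orthogonal_projection Y c) y = 0.
Proof.
move: c; apply: (xgetPex 0 (P := [set P : 'End('cV[R]_n) | forall c,
    P c \in Y /\ forall y, y \in Y -> dot (c - P c) y = 0]%classic)).
(* [g] takes inner products with a basis of [Y], so its kernel is the orthogonal complement of
   [Y]. *)
pose g : 'Hom('cV[R]_n, 'cV[R]_(\dim Y)) :=
  linfun (mulmx (\matrix_(i, j) (vbasis Y)`_i j 0)).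
have orthoP c : c \in lker g -> forall y, y \in Y -> dot c y = 0.
  rewrite memv_ker lfunE /= => /eqP /colP gc0 y yY.
  rewrite (coord_vbasis yY) dotC.
  elim/big_rec: _ => [|i z _ z0]; first by rewrite dotC dot0r.
  rewrite dotDl z0 addr0 dotZl (_ : dot (vbasis Y)`_i c = 0) ?mulr0 //.
  by have := gc0 i; rewrite !mxE => <-; apply: eq_bigr => j _; rewrite mxE.
have YI0 : (Y :&: lker g)%VS = 0%VS.
  apply/eqP; rewrite -subv0; apply/subvP => c /memv_capP[cY cg].
  by rewrite memv0 -dot_eq0; apply/eqP/orthoP.
have YDg : (Y + lker g)%VS = fullv.
  apply/eqP; rewrite eqEdim subvf /= dimv_disjoint_sum //.
  (* Rank-nullity: the image of [g] has dimension at most [\dim Y], so its kernel is large enough to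
     complement [Y]. *)
  rewrite -(limg_ker_dim g fullv) capfv addnC leq_add2r.
  by rewrite (leq_trans (dimvS (subvf _))) // dimvf /dim /= muln1.
exists (daddv_pi Y (lker g)) => c; split; first exact: memv_pi.
have <- : daddv_pi (lker g) Y c = c - daddv_pi Y (lker g) c.
  apply/eqP; rewrite eq_sym subr_eq addrC; apply/eqP/esym.
  by apply: daddv_pi_add; rewrite ?YDg ?memvf.
by apply: orthoP; exact: memv_pi.
Qed.

Lemma orthogonal_projection_dot (R : realType) n (Z : {vspace 'cV[R]_n}) c z :
  z \in Z -> dot z (orthogonal_projection Z c) = dot z c.
Proof.
move=> zZ; have [_ /(_ z zZ)] := orthogonal_projectionP Z c.
by rewrite dotBl !(dotC _ z) => /eqP; rewrite subr_eq0 => /eqP.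
Qed.

(** * Continuity and existence of minimizers *)

Lemma coord_hom_continuous (R : realType) m n (A : 'Hom('cV[R]_n, 'cV[R]_m)) i :
  continuous (fun x => A x i 0).
Proof.
have -> : (fun x => A x i 0) = (fun x => \sum_j x j 0 * A (delta_mx j 0) i 0).
  apply: funext => x; rewrite {1}(_ : x = \sum_j x j 0 *: delta_mx j 0).
    by rewrite linear_sum summxE; apply: eq_bigr => j _; rewrite linearZ mxE.
  by rewrite [LHS]matrix_sum_delta; apply: eq_bigr => j _; rewrite big_ord1.
apply: continuous_big => [|j _]; first exact: add_continuous.
by move=> x; apply: continuousM; [exact: coord_continuous|exact: cst_continuous].
Qed.

Lemma l1norm_hom_continuous (R : realType) m n (A : 'Hom('cV[R]_n, 'cV[R]_m)) :
  continuous (fun x => l1norm (A x)).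
Proof.
apply: continuous_big => [|j _]; first exact: add_continuous.
by move=> x; apply: continuous_comp; [exact: coord_hom_continuous|exact: norm_continuous].
Qed.

Lemma dot_hom_continuous (R : realType) m n (A : 'Hom('cV[R]_n, 'cV[R]_m)) :
  continuous (fun x => dot (A x) (A x)).
Proof.
apply: continuous_big => [|j _]; first exact: add_continuous.
by move=> x; apply: continuousM; exact: coord_hom_continuous.
Qed.

(** Heine-Borel and the extreme value theorem, applied to row vectors and carried over to columns by
    transposition. *)
Lemma closed_bounded_minimizer (R : realType) n (f : 'cV[R]_n -> R)
    (S : set 'cV[R]_n) (C : R) x0 :
  continuous f -> closed S -> S x0 ->
  (forall x, S x -> forall i, `|x i 0| <= C) ->
  exists2 c, S c & forall x, S x -> f c <= f x.
Proof.
move=> fcont Sclosed Sx0 Sbounded.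
have trcont : continuous (fun u : 'rV[R]_n => u^T).
  move=> u s /= /(nbhs_ballP u^T) [e e0 es].
  apply/nbhs_ballP; exists e => //= v [e0' uv]; apply: es; split=> // i j.
  by rewrite !mxE.
have Tclosed : closed ((fun u : 'rV[R]_n => u^T) @^-1` S)%classic.
  by apply: closed_comp => // u _; exact: trcont.
have Tcompact : compact ((fun u : 'rV[R]_n => u^T) @^-1` S)%classic.
  apply: bounded_closed_compact => //.
  (* The sup norm is a maximum started at 0, so the bound has to be nonnegative even when there are
     no coordinates. *)
  exists `|C|; split; first exact: num_real.
  move=> D CD u /Sbounded uC; rewrite /Num.norm /= mx_normrE.
  apply/bigmax_leP; split=> [|[i j] _ /=].
    exact: le_trans (normr_ge0 _) (ltW CD).
  have := uC j; rewrite mxE (ord1 i) => /le_trans -> //.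
  exact: le_trans (ler_norm _) (ltW CD).
have T0 : ((fun u : 'rV[R]_n => u^T) @^-1` S !=set0)%classic.
  by exists x0^T; rewrite /= trmxK.
have fTcont : continuous (fun u : 'rV[R]_n => f u^T).
  by move=> u; apply: continuous_comp; [exact: trcont|exact: fcont].
have [c cT cmin] := compact_EVT_min T0 Tcompact (continuous_subspaceT fTcont).
exists c^T; first exact: set_mem cT.
by move=> x Sx; rewrite -[x]trmxK; apply/cmin/mem_set; rewrite /= trmxK.
Qed.

(** * l1-perpendicularity and attainment of the Cheeger constant *)

Lemma l1norm_continuous (R : realType) n : continuous (@l1norm R n).
Proof.
have -> : @l1norm R n = (fun x => l1norm ((\1%VF : 'End(_)) x)).
  by apply: funext => y; rewrite lfunE.
exact: l1norm_hom_continuous.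
Qed.

Lemma closed_hom_fiber (R : realType) m n (A : 'Hom('cV[R]_n, 'cV[R]_m)) b :
  closed [set x | A x = b]%classic.
Proof.
have -> : [set x | A x = b]%classic =
    (\bigcap_i [set x | A x i 0 = b i 0])%classic.
  apply/seteqP; split=> x Axb; first by move=> i _; rewrite /= Axb.
  by apply/colP => i; exact: Axb.
apply: closed_bigI => i _; apply: (@closed_comp _ _ _ [set y | y = b i 0]%classic).
  by move=> x _; exact: coord_hom_continuous.
exact: closed_eq.
Qed.

(** The part of the coset [x + ker A] within l1-norm [l1norm x] is compact and contains [x]. A
    minimizer there is minimal on the whole coset, since the other points have larger norm. *)
Lemma l1norm_minimizer_coset (R : realType) m n
    (A : 'Hom('cV[R]_n, 'cV[R]_m)) x :
  exists2 z, A z = A x & l1_perp z (lker A).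
Proof.
have l1cont := @l1norm_continuous R n.
have Sclosed :
    closed [set z | A z = A x /\ l1norm z <= l1norm x]%classic.
  apply: closedI; first exact: closed_hom_fiber.
  apply: (@closed_comp _ _ _ [set y | y <= l1norm x]%classic) => [z _|].
    exact: l1cont.
  exact: closed_le.
have [|z [Azx lezx] zmin] := @closed_bounded_minimizer R n (@l1norm R n) _
  (l1norm x) x l1cont Sclosed (conj erefl (lexx _)).
  by move=> z [_ lezx] i; apply: le_trans lezx; exact: le_coord_l1norm.
exists z => // y; rewrite memv_ker => /eqP Ay0.
have [lezyx|/ltW lexzy] := leP (l1norm (z + y)) (l1norm x).
  by apply: zmin; split=> //; rewrite linearD /= Ay0 addr0.
exact: le_trans lezx lexzy.
Qed.

Lemma l1_perpZ (R : realType) n (x : 'cV[R]_n) (Y : {vspace 'cV[R]_n}) a :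
  l1_perp x Y -> l1_perp (a *: x) Y.
Proof.
move=> xY y yY; have [->|a0] := eqVneq a 0.
  by rewrite scale0r /l1norm big1 ?sumr_ge0 // => i _; rewrite mxE normr0.
rewrite -[y](scalerKV a0) -scalerDr !l1normZ ler_wpM2l //.
by apply: xY; rewrite memvZ.
Qed.

(** One closed condition per [y]; the l1-perpendicular vectors need not form a subspace, so
    closedness comes from continuity of the norm. *)
Lemma closed_l1_perp (R : realType) n (Y : {vspace 'cV[R]_n}) :
  closed [set x | l1_perp x Y]%classic.
Proof.
have -> : [set x | l1_perp x Y]%classic =
  (\bigcap_(y in [set y | y \in Y]) [set x | 0 <= l1norm (x + y) - l1norm x])%classic.
  apply/seteqP; split=> x xY y yY; first by rewrite /= subr_ge0 xY.
  by rewrite -subr_ge0; exact: xY.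
apply: closed_bigI => y _.
apply: (@closed_comp _ _ (fun x : 'cV[R]_n => l1norm (x + y) - l1norm x)
  [set t | 0 <= t]%classic); last exact: closed_ge.
have l1cont := @l1norm_continuous R n.
have addcont : continuous (fun x : 'cV[R]_n => x + y).
  by move=> z; apply: (@continuousD _ _ _ id (fun=> y)); 
    [exact: cvg_id|exact: cst_continuous].
have l1addcont : continuous (fun x : 'cV[R]_n => l1norm (x + y)).
  by move=> x; apply: continuous_comp; [exact: addcont|exact: l1cont].
by move=> x _; exact: (continuousB (l1addcont x) (l1cont x)).
Qed.

Lemma hom_neq0P (F : fieldType) (U W : vectType F) (A : 'Hom(U, W)) :
  A != 0 -> exists x, A x != 0.
Proof.
move=> A0; apply: contrapT => nA; case/eqP: A0; apply/lfunP => x.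
rewrite lfunE /=; apply/eqP; apply: contrapT => /negP ?.
by apply: nA; exists x.
Qed.

(** The quotient is invariant under scaling, so it suffices to minimize [l1norm (A x)] on the
    compact set of admissible vectors of l1-norm 1. This set is nonempty because a coset outside the
    kernel contains a nonzero admissible vector. *)
Lemma cheeger_minimizer (R : realType) m n (A : 'Hom('cV[R]_n, 'cV[R]_m)) :
  A != 0 ->
  exists x, [/\ x != 0, l1_perp x (lker A) & forall y, y != 0 ->
    l1_perp y (lker A) -> l1norm (A x) / l1norm x <= l1norm (A y) / l1norm y].
Proof.
move=> /hom_neq0P[x1 Ax10].
have [x0 Ax01 x0P] := l1norm_minimizer_coset A x1.
have x00 : x0 != 0 by apply: contra_neq Ax10 => x00; rewrite -Ax01 x00 linear0.
have l1cont := @l1norm_continuous R n.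
pose S := [set x : 'cV[R]_n | l1_perp x (lker A) /\ l1norm x = 1]%classic.
have unitS x : x != 0 -> l1_perp x (lker A) -> S ((l1norm x)^-1 *: x).
  move=> xn0 xP; split; first exact: l1_perpZ.
  by rewrite l1normZ ger0_norm ?invr_ge0 ?l1norm_ge0 // mulVf ?l1norm_eq0.
have Sclosed : closed S.
  apply: closedI; first exact: closed_l1_perp.
  apply: (@closed_comp _ _ _ [set t | t = 1 :> R]%classic) => [z _|].
    exact: l1cont.
  exact: closed_eq.
have [|x [xP nx1] xmin] := closed_bounded_minimizer (C := 1)
  (@l1norm_hom_continuous _ _ _ A) Sclosed (unitS _ x00 x0P).
  by move=> z [_ <-] i; exact: le_coord_l1norm.
exists x; split=> //; first by rewrite -l1norm_eq0 nx1 oner_eq0.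
move=> y yn0 yP; rewrite nx1 divr1 (le_trans (xmin _ (unitS y yn0 yP))) //.
by rewrite linearZ l1normZ ger0_norm ?invr_ge0 ?l1norm_ge0 // mulrC.
Qed.

(** * Eigenvalues of Gram operators and the abstract Cheeger inequality *)

Lemma leigenvalueP (F : fieldType) (U : vectType F) (f : 'End(U)) a :
  reflect (exists2 v, v != 0 & f v = a *: v) (passmx.leigenvalue f a).
Proof.
have eigE v : (v \in passmx.leigenspace f a) = (f v == a *: v).
  by rewrite memv_ker !lfunE /= opp_lfunE lfunE /= id_lfunE subr_eq0.
rewrite /passmx.leigenvalue -vpick0; apply: (iffP idP) => [v0|[v v0 fv]].
  by exists (vpick (passmx.leigenspace f a)) => //; apply/eqP; rewrite -eigE memv_pick.
rewrite vpick0; apply: contraNneq v0 => E0.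
by rewrite -memv0 -E0 eigE fv.
Qed.

Section GramOperator.
Variables (R : realType) (m n : nat) (A : 'Hom('cV[R]_n, 'cV[R]_m)).
Variable f : 'End('cV[R]_n).
(** States [f = A^T A] without an adjoint, so that the persistent and the ordinary Laplacian both
    become instances. *)
Hypothesis dot_f : forall x y, dot (f x) y = dot (A x) (A y).

Lemma gram_neq0 : f != 0 -> A != 0.
Proof.
apply: contra_neq => A0; apply/lfunP => x; apply: dot_ext => y.
by rewrite dot_f A0 !lfunE /= dot0r dotC dot0r.
Qed.

(* A minimizer of the Rayleigh quotient on the orthogonal complement of the
   kernel is an eigenvector, because its first variation vanishes; this avoids
   the spectral theorem. *)
Lemma rayleigh_minimizer : A != 0 ->
  exists mu x, [/\ mu != 0, x != 0, f x = mu *: x,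
    (forall k, k \in lker A -> dot x k = 0) &
    (forall h, (forall k, k \in lker A -> dot h k = 0) ->
       mu * dot h h <= dot (A h) (A h))].
Proof.
move=> /hom_neq0P[x1 Ax10].
have [Pk Pk0] := orthogonal_projectionP (lker A) x1.
set k1 := orthogonal_projection _ _ in Pk Pk0.
pose S := [set x : 'cV[R]_n |
  (forall k, k \in lker A -> dot x k = 0) /\ dot x x = 1]%classic.
have unitS x : x != 0 -> (forall k, k \in lker A -> dot x k = 0) ->
    S ((Num.sqrt (dot x x))^-1 *: x).
  move=> xn0 xP; split=> [k kA|]; first by rewrite dotZl (xP k kA) mulr0.
  rewrite dotZl dotZr mulrA -invfM -expr2 sqr_sqrtr ?dot_ge0 //.
  by rewrite mulVf // dot_eq0.
have Sclosed : closed S.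
  apply: closedI.
    change (closed (\bigcap_(k in [set k | k \in lker A])
                      [set x | dot x k = 0])%classic).
    apply: closed_bigI => k _.
    apply: (@closed_comp _ _ (fun x : 'cV[R]_n => dot x k) [set t | t = 0]%classic);
      last exact: closed_eq.
    move=> x _; apply: continuous_big => [|j _]; first exact: add_continuous.
    by move=> z; apply: continuousM; [exact: coord_continuous|exact: cst_continuous].
  apply: (@closed_comp _ _ (fun x : 'cV[R]_n => dot x x) [set t | t = 1]%classic);
    last exact: closed_eq.
  move=> x _; apply: continuous_big => [|j _]; first exact: add_continuous.
  by move=> z; apply: continuousM; exact: coord_continuous.
(* Subtracting the kernel component of [x1] leaves a nonzero vector of the complement, so [S] is
   inhabited. *)
have x10 : x1 - k1 != 0.
  apply: contra_neq Ax10 => /eqP; rewrite subr_eq0 => /eqP ->.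
  by apply/eqP; rewrite -memv_ker.
have [|x [xP x_1] xmin] := closed_bounded_minimizer (C := 1)
  (@dot_hom_continuous _ _ _ A) Sclosed (unitS _ x10 Pk0).
  move=> z [_ z1] i; rewrite -(@ler_pXn2r _ 2) ?nnegrE // expr1n -z1.
  rewrite real_normK ?num_real // expr2 /dot (bigD1 i) //= lerDl sumr_ge0 //.
  by move=> j _; rewrite -expr2 sqr_ge0.
pose mu := dot (A x) (A x).
have muP h : (forall k, k \in lker A -> dot h k = 0) ->
    mu * dot h h <= dot (A h) (A h).
  move=> hP; have [->|h0] := eqVneq h 0.
    by rewrite linear0 !dot0r mulr0.
  have := xmin _ (unitS h h0 hP); rewrite linearZ dotZl dotZr mulrA -invfM -expr2.
  by rewrite sqr_sqrtr ?dot_ge0 // mulrC ler_pdivlMr ?dot_gt0.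
have xn0 : x != 0 by rewrite -dot_eq0 x_1 oner_eq0.
have stationary h : (forall k, k \in lker A -> dot h k = 0) ->
    dot (A x) (A h) = mu * dot x h.
  move=> hP.
  pose b := dot (A x) (A h) - mu * dot x h; pose c := dot (A h) (A h) - mu * dot h h.
  (* [mu] bounds the quotient at [x + t h]: a quadratic in t that is >= 0. *)
  have quad t : 0 <= 2 * t * b + t ^+ 2 * c.
    have := muP (t *: h + x); rewrite linearP !(dotPl, dotDr, dotZr).
    rewrite -/mu x_1 (dotC h x) (dotC (A h) (A x)).
    have -> : (forall k, k \in lker A -> dot (t *: h + x) k = 0) = True.
      by apply/propT => k kA; rewrite dotPl hP // xP // mulr0 addr0.
    move=> /(_ I); rewrite -subr_ge0 => /le_trans -> //.
    by rewrite le_eqVlt; apply/orP; left; apply/eqP; rewrite /b /c; ring.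
  have c0 : 0 <= c by rewrite subr_ge0 muP.
  apply/eqP; rewrite -subr_eq0 -/b -sqrf_eq0 eq_le sqr_ge0 andbT.
  (* The vertex of the parabola is at [- b / c]; [c + 1] keeps the denominator positive when
     [c = 0], and the value is still negative unless [b = 0]. *)
  have := quad (- b / (c + 1)).
  have -> : 2 * (- b / (c + 1)) * b + (- b / (c + 1)) ^+ 2 * c =
    b ^+ 2 * (- (c + 2) / (c + 1) ^+ 2) by field; lra.
  have : (c + 2) / (c + 1) ^+ 2 > 0 by rewrite divr_gt0 ?exprn_gt0 //; lra.
  by rewrite mulNr => d0; rewrite mulrN oppr_ge0 pmulr_lle0.
exists mu, x; split=> //.
  (* If [mu] vanished, [x] would lie in the kernel and be orthogonal to itself. *)
  rewrite dot_eq0 -memv_ker; apply: contra xn0 => /xP /eqP.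
  by rewrite dot_eq0.
apply: dot_ext => h; rewrite dot_f dotZl.
(* Stationarity covers test vectors orthogonal to the kernel; the kernel component of [h]
   contributes 0 to both sides. *)
have [Ph hP] := orthogonal_projectionP (lker A) h.
set k := orthogonal_projection _ _ in Ph hP.
rewrite -[h](subrK k); move: (h - k) hP => h' h'P.
rewrite linearD !dotDr stationary // (xP k) //=.
by move: Ph; rewrite memv_ker => /eqP ->; rewrite dot0r !addr0.
Qed.

(** An eigenvector [v] for [a != 0] is orthogonal to the kernel, because
    [a * dot v k = dot (A v) (A k) = 0]; the Rayleigh bound then gives [mu <= a]. *)
Lemma smallest_nonzero_eigenvalue_gram : f != 0 ->
  exists x, let mu := smallest_nonzero_eigenvalue f in
  [/\ 0 < mu, x != 0, f x = mu *: x,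
    (forall k, k \in lker A -> dot x k = 0) &
    (forall h, (forall k, k \in lker A -> dot h k = 0) ->
       mu * dot h h <= dot (A h) (A h))].
Proof.
move=> /gram_neq0 /rayleigh_minimizer [mu [x [mu0 x0 fx xP muP]]].
have eig_dot a v : f v = a *: v -> dot (A v) (A v) = a * dot v v.
  by move=> fv; rewrite -dot_f fv dotZl.
have -> : smallest_nonzero_eigenvalue f = mu.
  apply: minimumE => [|a [/leigenvalueP[v v0 fv] a0]].
    by split=> //; apply/leigenvalueP; exists x.
  have vP k : k \in lker A -> dot v k = 0.
    rewrite memv_ker => /eqP Ak; apply: (mulfI a0).
    by rewrite -dotZl -fv dot_f Ak mulr0 dot0r.
  have := muP v vP; rewrite (eig_dot _ _ fv) ler_pM2r //.
  by rewrite dot_gt0.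
exists x; split=> //; rewrite lt_def mu0.
by have := dot_ge0 (A x); rewrite (eig_dot _ _ fx) pmulr_lge0 // dot_gt0.
Qed.

Lemma cheeger_gram : f != 0 ->
  let lambda := smallest_nonzero_eigenvalue f in
  let phi := minimum [set l1norm (A x) / l1norm x
                     | x in [set x | x != 0 /\ l1_perp x (lker A)]]%classic in
  phi ^+ 2 / m%:R <= lambda /\ lambda <= n%:R * phi ^+ 2.
Proof.
move=> f0 lambda phi.
have [x [lambda0 x0 fx xP lambdaP]] := smallest_nonzero_eigenvalue_gram f0.
rewrite -/lambda in lambda0 fx lambdaP.
have [y [y0 yP ymin]] := cheeger_minimizer (gram_neq0 f0).
have phiE : phi = l1norm (A y) / l1norm y.
  apply: minimumE; first by exists y.
  by move=> _ [z [z0 zP] <-]; exact: ymin.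
have l1_gt0 (z : 'cV[R]_n) : z != 0 -> 0 < l1norm z.
  by move=> z0; rewrite lt_def l1norm_eq0 z0 l1norm_ge0.
split.
  have [z Azx zP] := l1norm_minimizer_coset A x.
  have Ax0 : dot (A x) (A x) = lambda * dot x x by rewrite -dot_f fx dotZl.
  have zx_ker : z - x \in lker A by rewrite memv_ker linearB /= Azx subrr.
  (* Pythagoras: [z] is [x] plus a kernel vector, which is orthogonal to [x]. *)
  have xz : dot x x <= dot z z.
    rewrite -[z](subrK x); move: (z - x) zx_ker => w w_ker.
    by rewrite dotDr !dotDl (dotC w x) (xP _ w_ker) addr0 add0r lerDr dot_ge0.
  have xx0 : 0 < dot x x by rewrite dot_gt0.
  have z0 : z != 0 by rewrite -dot_gt0 (lt_le_trans xx0).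
  have m0 : 0 < m%:R :> R.
    (* With [m = 0] the codomain would be trivial, whereas [A x] has positive square norm. *)
    rewrite ltr0n lt0n; apply/eqP => m0.
    have : 0 < dot (A x) (A x) by rewrite Ax0 mulr_gt0.
    by rewrite /dot big1 ?ltxx // => i; have := ltn_ord i; rewrite {2}m0.
  rewrite ler_pdivrMr // phiE.
  have phi_z : (l1norm (A y) / l1norm y) ^+ 2 <= (l1norm (A z) / l1norm z) ^+ 2.
    by rewrite ler_pXn2r ?nnegrE ?divr_ge0 ?l1norm_ge0 ?ymin.
  apply: le_trans phi_z _; rewrite expr_div_n ler_pdivrMr ?exprn_gt0 ?l1_gt0 //.
  apply: le_trans (l1norm_le_dot _) _; rewrite Azx Ax0 mulrA [m%:R * _]mulrC.
  by rewrite ler_wpM2l ?mulr_ge0 ?ler0n ?(ltW lambda0) // (le_trans xz (dot_le_l1norm _)).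
have [Pk yk] := orthogonal_projectionP (lker A) y.
set k := orthogonal_projection _ _ in Pk yk.
have Ayk : A (y - k) = A y.
  by move: Pk; rewrite memv_ker linearB /= => /eqP ->; rewrite subr0.
rewrite phiE expr_div_n mulrA ler_pdivlMr ?exprn_gt0 ?l1_gt0 //.
(* The kernel vector [- k] serves as competitor in the l1-perpendicularity of [y]. *)
have yk1 : l1norm y ^+ 2 <= n%:R * dot (y - k) (y - k).
  apply: le_trans (l1norm_le_dot _).
  by rewrite ler_pXn2r ?nnegrE ?l1norm_ge0 // yP // memvN.
apply: le_trans (ler_wpM2l (ltW lambda0) yk1) _.
rewrite mulrCA ler_wpM2l ?ler0n // (le_trans (lambdaP _ yk)) // Ayk.
exact: dot_le_l1norm.
Qed.

End GramOperator.

(** * The persistent up Laplacian as a Gram operator *)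

Lemma adjointP (R : realType) (U W : vectType R) (ipU : U -> U -> R)
    (ipW : W -> W -> R) (f : 'Hom(U, W)) (g : 'Hom(W, U)) :
  (forall u w, ipW (f u) w = ipU u (g w)) ->
  forall u w, ipW (f u) w = ipU u (adjoint ipU ipW f w).
Proof.
move=> fg; exact: (xgetPex 0 (P := [set g : 'Hom(W, U) |
  forall u w, ipW (f u) w = ipU u (g w)]%classic) (ex_intro _ g fg)).
Qed.

Section Subcomplex.
Variables (R : realType) (V : finType) (o : orientation V).
Variables (K L : simplicial_complex V) (q : nat).
Hypothesis sKL : faces K \subset faces L.

Local Notation incl := (chain_inclusion R K L q).
Local Notation Y := (relative_chains R o K L q).
Local Notation inclusion_mx := (\matrix_(i < #|simplices L q|, j < #|simplices K q|)
  (enum_val i == enum_val j)%:R : 'M[R]_(_, _)).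

(** Column [i] of the inclusion matrix is the unit vector at the position of the same simplex in
    [L], so the transpose selects rows. *)
Lemma inclusion_mx_tr_mulmx p (M : 'M[R]_(#|simplices L q|, p)) (i : 'I_#|simplices K q|)
    (i' : 'I_#|simplices L q|) j :
  enum_val i' = enum_val i -> (inclusion_mx^T *m M) i j = M i' j.
Proof.
move=> ii'; rewrite mxE (bigD1 i') //= !mxE ii' eqxx mul1r big1 ?addr0 // => k ki'.
by rewrite !mxE -ii' (inj_eq enum_val_inj) (negbTE ki') mul0r.
Qed.

Lemma simplices_sub (i : 'I_#|simplices K q|) :
  exists i' : 'I_#|simplices L q|, enum_val i' = enum_val i.
Proof.
have iL : enum_val i \in simplices L q.
  have := enum_valP i; rewrite !inE => /andP[iK ->]; rewrite andbT.
  exact: (fintype.subsetP sKL).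
by exists (enum_rank_in iL (enum_val i)); rewrite enum_rankK_in.
Qed.

Lemma inclusion_mx_trK : inclusion_mx^T *m inclusion_mx = 1%:M.
Proof.
apply/matrixP => i j; have [i' ii'] := simplices_sub i.
by rewrite (inclusion_mx_tr_mulmx _ _ ii') !mxE ii' (inj_eq enum_val_inj).
Qed.

Lemma inclusion_mx_tr_boundary :
  inclusion_mx^T *m boundary_mx R o L L q = boundary_mx R o K L q.
Proof.
apply/matrixP => i j; have [i' ii'] := simplices_sub i.
by rewrite (inclusion_mx_tr_mulmx _ _ ii') !mxE ii'.
Qed.

(** [incl^-1] is a genuine inverse only on the image of [incl], where boundaries of relative chains
    lie by definition. There it agrees with the transposed inclusion, which cuts the boundary matrix
    down to the rows of [K]. *)
Lemma persistent_boundaryE u :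
  persistent_boundary R o K L q u = boundary_mx R o K L q *m vsval u.
Proof.
set v := vsval u.
have -> : persistent_boundary R o K L q u = (incl^-1)%VF (boundary R o L q v).
  by rewrite !comp_lfunE [linfun vsval u]lfunE.
have vY : boundary R o L q v \in limg incl.
  by have := subvsP u; rewrite /relative_chains -memv_preim.
rewrite -[LHS]mul1mx -inclusion_mx_trK -mulmxA.
have -> : inclusion_mx *m incl^-1%VF (boundary R o L q v) = boundary R o L q v.
  by rewrite -[RHS](limg_lfunVK vY); exact/esym/lfunE.
by rewrite lfunE /= mulmxA inclusion_mx_tr_boundary.
Qed.

(** For [u] in [Y], [dot (B u) w = dot u (B^T w) = dot u (P B^T w)], so [P B^T] with values in [Y]
    is an adjoint. *)
Lemma persistent_adjointE x :
  vsval (adjoint (fun u v : subvs_of Y => dot (vsval u) (vsval v)) (@dot R _)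
           (persistent_boundary R o K L q) x) = projected_coboundary R o K L q x.
Proof.
set PBt := projected_coboundary R o K L q.
have PBtY w : PBt w \in Y.
  by rewrite comp_lfunE; case: (orthogonal_projectionP Y
    (linfun (mulmx (boundary_mx R o K L q)^T) w)).
have PBtP u w : dot (persistent_boundary R o K L q u) w = dot (vsval u) (PBt w).
  rewrite persistent_boundaryE dot_mulmx comp_lfunE orthogonal_projection_dot ?subvsP //.
  by rewrite lfunE.
pose g := (linfun (vsproj Y) \o PBt)%VF.
have gP u w : dot (persistent_boundary R o K L q u) w = dot (vsval u) (vsval (g w)).
  by rewrite PBtP [g w]comp_lfunE [linfun (vsproj Y) _]lfunE /= vsprojK.
have adjP := @adjointP R _ _ (fun u v : subvs_of Y => dot (vsval u) (vsval v))
  (@dot R _) _ g gP.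
set D := adjoint _ _ _ in adjP *.
apply/eqP; rewrite -subr_eq0 -dot_eq0; apply/eqP.
(* Uniqueness of the adjoint: the difference of the two candidates is tested against itself. *)
have := adjP (D x - vsproj Y (PBt x)) x.
rewrite PBtP linearB /= vsprojK // => /eqP.
by rewrite eq_sym -subr_eq0 !(dotC (_ - _)) -dotBl => /eqP.
Qed.

(** Moving [B] across gives [dot (P B^T x) (B^T y)]; as the left vector lies in [Y], the right one
    may be projected. *)
Lemma dot_persistent_up_laplacian x y :
  dot (persistent_up_laplacian R o K L q x) y =
  dot (projected_coboundary R o K L q x) (projected_coboundary R o K L q y).
Proof.
rewrite comp_lfunE persistent_boundaryE persistent_adjointE dot_mulmx.
rewrite [in RHS]comp_lfunE [in RHS]comp_lfunE.
rewrite [in RHS]orthogonal_projection_dot; last by case: (orthogonal_projectionP Y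
    (linfun (mulmx (boundary_mx R o K L q)^T) x)).
by rewrite comp_lfunE [X in dot _ X = _](_ : _ = linfun (mulmx (boundary_mx R o K L q)^T) y)
  ?lfunE.
Qed.

End Subcomplex.

(** * The case [K = L] *)

Lemma relative_chains_self (R : realType) (V : finType) (o : orientation V)
    (L : simplicial_complex V) (q : nat) : relative_chains R o L L q = fullv.
Proof.
apply/eqP; rewrite eqEsubv subvf; apply/subvP => c _.
rewrite /relative_chains -memv_preim; apply/memv_imgP.
exists (boundary R o L q c); first exact: memvf.
rewrite [RHS]lfunE /=.
rewrite (_ : \matrix_(i, j) _ = 1%:M) ?mul1mx //.
by apply/matrixP => i j; rewrite !mxE (inj_eq enum_val_inj).
Qed.

(** With every chain relative, the projection is the identity and [P B^T] is the plain transpose,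
    which is also the adjoint of the boundary. *)
Lemma dot_up_laplacian (R : realType) (V : finType) (o : orientation V)
    (L : simplicial_complex V) (q : nat) x y :
  dot (up_laplacian R o L q x) y =
  dot (projected_coboundary R o L L q x) (projected_coboundary R o L L q y).
Proof.
set M := boundary_mx R o L L q.
have adjE w : adjoint (@dot R _) (@dot R _) (boundary R o L q) w = M^T *m w.
  pose g : 'Hom(chains R L q, chains R L q.+1) := linfun (mulmx M^T).
  have gP u v : dot (boundary R o L q u) v = dot u (g v).
    by rewrite [boundary R o L q u]lfunE [g v]lfunE /= dot_mulmx.
  apply: dot_ext => u; rewrite dotC -(adjointP gP) gP [g w]lfunE /=.
  exact: dotC.
have PBtE w : projected_coboundary R o L L q w = M^T *m w.
  rewrite comp_lfunE [X in orthogonal_projection _ X]lfunE /=; apply: dot_ext => u.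
  by rewrite dotC orthogonal_projection_dot ?relative_chains_self ?memvf // dotC.
by rewrite !PBtE comp_lfunE adjE lfunE /= [LHS]dot_mulmx.
Qed.

Theorem mainTheorem1 (R : realType) (V : finType) (o : orientation V)
    (L : simplicial_complex V) (q : nat) :
  (forall K : simplicial_complex V, faces K \subset faces L ->
     persistent_up_laplacian R o K L q != 0 ->
     let lambda := smallest_nonzero_eigenvalue
                     (persistent_up_laplacian R o K L q) in
     let phi := persistent_cheeger R o K L q in
     phi ^+ 2 / #|simplices L q.+1|%:R <= lambda /\
     lambda <= #|simplices K q|%:R * phi ^+ 2) /\
  (up_laplacian R o L q != 0 ->
     let lambda := smallest_nonzero_eigenvalue (up_laplacian R o L q) in
     let phi := persistent_cheeger R o L L q in
     phi ^+ 2 / #|simplices L q.+1|%:R <= lambda /\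
     lambda <= #|simplices L q|%:R * phi ^+ 2).

Proof.
split=> [K sKL|] lap0.
  (* [persistent_cheeger] unfolds to the minimum in [cheeger_gram] for [A = P B^T], whose dimensions
     [m] and [n] are the two simplex counts. *)
  apply: (cheeger_gram _ lap0) => x y.
  exact: dot_persistent_up_laplacian.
apply: (cheeger_gram _ lap0) => x y.
exact: dot_up_laplacian.
Qed.
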